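(* Let $K$ be a field and let $A\in \mathrm{M}_n(K)$ be a matrix with trace zero. Then $A=[X,Y]$ for some $X,Y\in \mathrm{M}_n(K)$, where $X$ is regular. More precisely, if $A$ is non-scalar, $X$ can be chosen to be conjugate to $P_n$, while if $A$ is scalar we can take $X=J_n(0)$.
   Context: $[X,Y]=XY-YX$. A matrix $X\in \mathrm{M}_n(K)$ is regular if there exists $v\in K^n$ such that $\{v,Xv,\dots,X^{n-1}v\}$ is a basis of $K^n$. A matrix is scalar if it is a scalar multiple of the identity matrix. For $n\geq 2$ and $k=\lfloor n/2\rfloor$, the matrix $P_n=(p_{ij})\in \mathrm{M}_n(K)$ is defined by $p_{ii}=1$ for $i=2,4,\dots,2k$; $p_{i,i-2}=1$ for $i=3,4,\dots,n$; and $p_{ij}=0$ otherwise. $J_n(0)$ is the $n\times n$ Jordan block with eigenvalue $0$ and $1$s on the subdiagonal (i.e. entries $(i+1,i)$ equal to $1$ for $1\leq i\leq n-1$ and all other entries $0$). Conjugate means conjugate by an element of $\mathrm{GL}_n(K)$. *)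

(* Defs.v *)
From mathcomp Require Import all_boot all_algebra.
Set Implicit Arguments.
Unset Strict Implicit.
Unset Printing Implicit Defensive.
Import GRing.Theory.
Local Open Scope ring_scope.

Definition mxbracket (K : fieldType) (n : nat) (X Y : 'M[K]_n) : 'M[K]_n :=
  X *m Y - Y *m X.

Definition regular_mx (K : fieldType) (n : nat) (X : 'M[K]_n) : Prop :=
  exists v : 'cV[K]_n,
    basis_of fullv [seq X ^+ i *m v | i <- iota 0 n].

Definition conjugate_mx (K : fieldType) (n : nat) (X Y : 'M[K]_n) : Prop :=
  exists2 g : 'M[K]_n, g \in unitmx & X = g *m Y *m invmx g.

(* With 1-based indices: ones at (i, i) for i even and at (i, i-2) for i >= 3.
   Elements of 'I_n start at 0, so even positions become odd. *)
Definition P_mx (K : fieldType) (n : nat) : 'M[K]_n :=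
  \matrix_(i < n, j < n)
    (((i == j :> nat) && odd i) || (i == j.+2 :> nat))%:R.

Definition J0_mx (K : fieldType) (n : nat) : 'M[K]_n :=
  \matrix_(i < n, j < n) (i == j.+1 :> nat)%:R.

(* Main.v *)
Require Import Defs.
From HB Require Import structures.
From mathcomp Require Import all_boot all_algebra.
Import GRing.Theory.
Local Open Scope ring_scope.
Set Implicit Arguments.
Unset Strict Implicit.
Unset Printing Implicit Defensive.

(** The trace form is nondegenerate on matrices and the map [X, -] is
    skew-adjoint for it, so the image of [X, -] is the orthogonal of its kernel:
    A is a bracket [X, Y] exactly when tr (A Z) = 0 for every Z commuting with X
    (mxbracket_range gives the direction that matters). It remains to choose X
    with a centralizer whose orthogonal contains a conjugate of A.

    Everything commuting with P_n is lower triangular, supported on the entries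
    whose two indices have equal parity, with a diagonal that depends on the
    parity only: P_n is a direct sum of two Jordan blocks, one with eigenvalue 0
    on the even indices (counted from 0) and one with eigenvalue 1 on the odd
    indices, and a matrix commuting with it is a polynomial in each block. Hence
    a Hessenberg matrix B, one with no entry above the first superdiagonal, only
    meets the centralizer of P_n along the diagonal, and it is a bracket [P_n, Y]
    as soon as the odd-indexed and the even-indexed halves of its diagonal both
    have sum 0 (hessenberg_bracket_P).

    A non-scalar A of trace 0 is conjugate to such a B. Some row vector w is not
    an eigenvector of A; a Hessenberg form of A in a basis starting with w
    (hessenberg_form) then has a nonzero entry at (0, 1). Conjugation by
    1 + x E_(1, 0) keeps the Hessenberg shape and moves x B_(0, 1) from the
    diagonal entry 0 to the diagonal entry 1, so a suitable x makes the odd half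
    of the diagonal sum to 0 (hessenberg_shear); the even half follows by the
    trace. If instead A = a 1 has trace n a = 0, the matrices commuting with
    J_n(0) have constant diagonal, and tr (a Z) = n a Z_(0, 0) = 0.

    Regularity of P_n and J_n(0) comes from a Newton-type sequence
    u_(k+1) = (X - c_k) u_k: its terms lie in the span of the powers of X applied
    to u_0, and for both matrices they are triangular (cyclic_newton). *)

(** * Brackets and centralizers *)

Lemma mxvec_dot_trace (K : fieldType) (m n : nat) (A C : 'M[K]_(m, n)) :
  mxvec A *m (mxvec C)^T = (\tr (A *m C^T))%:M.
Proof.
rewrite [LHS]mx11_scalar; congr _%:M.
rewrite mxE (reindex _ (curry_mxvec_bij _ _)) /=.
rewrite /mxtrace (eq_bigr (fun i => \sum_j A i j * C i j)); last first.
  by move=> i _; rewrite mxE; apply: eq_bigr => j _; rewrite mxE.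
rewrite pair_bigA /=; apply: eq_bigr => -[i j] _ /=.
by rewrite mxvecE mxE mxvecE.
Qed.

(** Testing against the matrix units recovers every entry of M. *)
Lemma mxtrace_nondegenerate (K : fieldType) (n : nat) (M : 'M[K]_n) :
  (forall Y, \tr (Y *m M) = 0) -> M = 0.
Proof.
move=> trM; apply/matrixP=> i j; rewrite mxE -[RHS](trM (delta_mx j i)).
rewrite /mxtrace (bigD1 j) //= big1 ?addr0 => [|k kj].
  rewrite mxE (bigD1 i) //= big1 ?addr0 ?mxE ?eqxx ?mul1r // => l li.
  by rewrite mxE (negPf li) andbF mul0r.
by rewrite mxE big1 // => l _; rewrite mxE (negPf kj) mul0r.
Qed.

Fact mxbracket_is_linear (K : fieldType) (n : nat) (X : 'M[K]_n) :
  linear (mxbracket X).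
Proof.
move=> a Y Z; rewrite /mxbracket mulmxDr mulmxDl -scalemxAr -scalemxAl.
by rewrite scalerBr opprD addrACA.
Qed.

HB.instance Definition _ (K : fieldType) (n : nat) (X : 'M[K]_n) :=
  GRing.isLinear.Build K 'M[K]_n 'M[K]_n *:%R (mxbracket X)
    (mxbracket_is_linear X).

(** The range of a linear map consists of the vectors killed by its cokernel.
    A column of the cokernel of [X, -], read as a matrix through the trace form,
    is orthogonal to all brackets [X, Y]; since tr ([X, Y] Z) = tr (Y [Z, X]),
    this says that it commutes with X. *)
Lemma mxbracket_range (K : fieldType) (n : nat) (X A : 'M[K]_n) :
  (forall Z, X *m Z = Z *m X -> \tr (A *m Z) = 0) ->
  exists Y, A = mxbracket X Y.
Proof.
move=> trA; suff /submxP[w defA] : (mxvec A <= lin_mx (mxbracket X))%MS.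
  exists (vec_mx w); apply: (can_inj mxvecK).
  by rewrite -mul_vec_lin vec_mxK.
rewrite submxE; set L := lin_mx _.
apply/eqP/matrixP=> i k; rewrite [i]ord1 [RHS]mxE.
pose C := vec_mx (col k (cokermx L))^T.
have colC : col k (cokermx L) = (mxvec C)^T by rewrite vec_mxK trmxK.
have entryC (Y : 'M[K]_n) : (mxvec Y *m cokermx L) 0 k = \tr (Y *m C^T).
  transitivity ((mxvec Y *m col k (cokermx L)) 0 0).
    by rewrite !mxE; apply: eq_bigr => j _; rewrite !mxE.
  by rewrite colC mxvec_dot_trace mxE eqxx.
rewrite entryC; apply: trA; apply/eqP; rewrite -subr_eq0 -oppr_eq0 opprB.
apply/eqP/mxtrace_nondegenerate => Y.
rewrite mulmxBr raddfB /= [in X in X - _]mulmxA.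
rewrite [Y *m (X *m _)]mulmxA [in X in X - _]mxtrace_mulC mulmxA.
rewrite -raddfB /= -mulmxBl -/(mxbracket X Y).
by rewrite -entryC -mul_vec_lin -mulmxA mulmx_coker mulmx0 mxE.
Qed.

Lemma conj_bracket (K : fieldType) (n : nat) (A B P Y g : 'M[K]_n) :
  g \in unitmx -> g *m A = B *m g -> B = mxbracket P Y ->
  A = mxbracket (invmx g *m P *m g) (invmx g *m Y *m g).
Proof.
move=> gU gA EB; rewrite -[A](mulKmx gU) gA EB /mxbracket mulmxBl mulmxBr.
by rewrite !mulmxA !mulmxK.
Qed.

(** * Cyclic vectors *)

(** The coefficients are indexed by nat rather than by ordinals so that
    expansions of different lengths can be compared. *)
Definition cyclic_vector (K : fieldType) (n : nat) (X : 'M[K]_n)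
    (v : 'cV[K]_n) :=
  forall w : 'cV[K]_n, exists c : nat -> K,
    w = \sum_(i < n) c i *: (X ^+ i *m v).

Lemma regular_cyclic (K : fieldType) (n : nat) (X : 'M[K]_n) v :
  cyclic_vector X v -> regular_mx X.
Proof.
move=> gen; exists v; rewrite basisEdim size_map size_iota dimvf dim_matrix.
rewrite [(n * _)%R]muln1 leqnn andbT; apply/subvP=> w _; have [c ->] := gen w.
apply: memv_suml => i _; apply/memvZ/memv_span/mapP.
by exists (i : nat); rewrite ?mem_iota ?add0n /=.
Qed.

Lemma cyclic_vector_conj (K : fieldType) (n : nat) (X g : 'M[K]_n) v :
  g \in unitmx -> cyclic_vector X v ->
  cyclic_vector (g *m X *m invmx g) (g *m v).
Proof.
move=> gU gen w; have [c Ec] := gen (invmx g *m w); exists c.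
rewrite -[w](mulKVmx gU) Ec mulmx_sumr; apply: eq_bigr => i _.
rewrite -scalemxAr; congr (_ *: _).
set Y := g *m X *m invmx g; have gX : g *m X = Y *m g by rewrite mulmxKV.
elim: (i : nat) => [|k IH]; first by rewrite !expr0 !mul1mx.
by rewrite !exprS -!mulmxE -[RHS]mulmxA -IH !mulmxA gX.
Qed.

(** The analogue of the Newton basis of interpolation: term k is the polynomial
    (X - c_0) ... (X - c_(k-1)) applied to v. *)
Fixpoint newton (K : fieldType) (n : nat) (X : 'M[K]_n) (c : nat -> K)
    (v : 'cV[K]_n) (k : nat) : 'cV[K]_n :=
  if k is k'.+1 then
    X *m newton X c v k' - c k' *: newton X c v k'
  else v.

Lemma newton_expand (K : fieldType) (n : nat) (X : 'M[K]_n) c v k :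
  exists d : nat -> K, newton X c v k = \sum_(i < k.+1) d i *: (X ^+ i *m v).
Proof.
elim: k => [|k [d IH]] /=.
  by exists (fun=> 1); rewrite big_ord1 scale1r expr0 mul1mx.
(* d1 shifts the coefficients (multiplication by X), d2 pads them with a 0. *)
pose d1 i := if i is j.+1 then d j else 0.
pose d2 i := if (i < k.+1)%N then d i else 0.
exists (fun i => d1 i - c k * d2 i); rewrite IH.
rewrite [RHS](eq_bigr (fun i : 'I__ => d1 i *: (X ^+ i *m v)
  - c k *: (d2 i *: (X ^+ i *m v)))); last first.
  by move=> i _; rewrite /= scalerBl scalerA.
rewrite sumrB; congr (_ - _).
  rewrite [RHS]big_ord_recl scale0r add0r mulmx_sumr; apply: eq_bigr => i _.
  by rewrite /= exprS -mulmxE -scalemxAr mulmxA.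
rewrite [RHS]big_ord_recr /= /d2 ltnn scale0r scaler0 addr0 scaler_sumr.
by apply: eq_bigr => i _; rewrite ltn_ord.
Qed.

(** A triangular family with nonzero diagonal is a basis, and each of its terms
    is a combination of the powers of X applied to v. *)
Lemma cyclic_newton (K : fieldType) (n : nat) (X : 'M[K]_n) c v :
  (forall i j : 'I_n, (i < j)%N -> newton X c v j i 0 = 0) ->
  (forall i : 'I_n, newton X c v i i 0 != 0) ->
  cyclic_vector X v.
Proof.
move=> u0 un0 w; pose U := \matrix_(i < n, j < n) newton X c v j i 0.
have Uunit : U \in unitmx.
  rewrite unitmxE det_trig.
    by rewrite unitfE; apply/prodf_neq0 => i _; rewrite mxE.
  by apply/is_trig_mxP => i j ij; rewrite mxE u0.
have {}Ew : w = \sum_(j < n) (invmx U *m w) j 0 *: newton X c v j.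
  rewrite -{1}[w](mulKVmx Uunit); apply/matrixP=> i z; rewrite [z]ord1.
  by rewrite summxE mxE; apply: eq_bigr => j _; rewrite !mxE mulrC.
have span (j : 'I_n) : exists d : nat -> K,
    newton X c v j = \sum_(i < n) d i *: (X ^+ i *m v).
  have [d ->] := newton_expand X c v j.
  exists (fun i => if (i < j.+1)%N then d i else 0).
  rewrite (big_ord_widen n (fun i => d i *: (X ^+ i *m v))) //.
  rewrite big_mkcond; apply: eq_bigr => i _.
  by case: ifP => // _; rewrite scale0r.
rewrite Ew; elim/big_rec: _ => [|j y _ [d ->]].
  by exists (fun=> 0); rewrite big1 // => i _; rewrite scale0r.
have [e ->] := span j; set a := _ *m _; exists (fun i => a j 0 * e i + d i).
rewrite scaler_sumr -big_split; apply: eq_bigr => i _.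
by rewrite scalerA scalerDl.
Qed.

(** * Hessenberg form *)

Definition hessenberg (K : fieldType) (n : nat) (B : 'M[K]_n) :=
  forall i j : 'I_n, (i.+1 < j)%N -> B i j = 0.

Lemma unitmx_row0 (K : fieldType) (n : nat) (w : 'rV[K]_n.+1) :
  w != 0 -> exists2 g : 'M[K]_n.+1, g \in unitmx & row 0 g = w.
Proof.
move=> w0; have rw : \rank w = 1%N by rewrite rank_rV w0.
have := mulmx_ebase w; rewrite rw [col_ebase w]mx11_scalar mul_scalar_mx.
set c := col_ebase w 0 0 => Ew.
have c0 : c != 0.
  by apply: contraNneq w0 => c0; rewrite -Ew c0 scale0r mul0mx.
exists (c *: row_ebase w); first by rewrite unitmxZ ?unitfE ?row_ebase_unit.
rewrite rowE -scalemxAr -[RHS]Ew -scalemxAl; congr (_ *: (_ *m _)).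
by apply/matrixP=> i j; rewrite !mxE [i]ord1 eqxx /= andbT eq_sym.
Qed.

(** Prescribing the first basis vector w is what lets the induction go through:
    once w is placed in row 0, write D in blocks with corner entry of size 1. The
    remaining basis is chosen for the lower right block so that its first vector
    spans the upper right block, which then becomes a multiple of the first unit
    vector. *)
Lemma hessenberg_form (K : fieldType) (n : nat) (D : 'M[K]_n.+1)
    (w : 'rV[K]_n.+1) : w != 0 ->
  exists g B : 'M[K]_n.+1,
    [/\ g \in unitmx, row 0 g = w, hessenberg B & g *m D = B *m g].
Proof.
elim: n D w => [|n IH] D w w0; have [g gU g0] := unitmx_row0 w0.
  exists g, (g *m D *m invmx g); split; rewrite ?mulmxKV // => i j.
  by rewrite [j]ord1.
pose D' : 'M_(1 + n.+1) := g *m D *m invmx g.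
(* When the upper right block vanishes, any nonzero first vector will do. *)
have [w' w'0 [a Ea]] : exists2 w' : 'rV[K]_n.+1, w' != 0 &
    exists a, ursubmx D' = a *: w'.
  have [u0|u0] := eqVneq (ursubmx D') 0.
    exists 'e_0; last by exists 0; rewrite u0 scale0r.
    by apply/eqP=> /matrixP/(_ 0 0)/eqP; rewrite !mxE !eqxx oner_eq0.
  by exists (ursubmx D'); last by exists 1; rewrite scale1r.
have [h [H [hU h0 hH hEH]]] := IH (drsubmx D') w' w'0.
pose k : 'M_(1 + n.+1) := block_mx 1%:M 0 0 h.
have kU : k \in unitmx by rewrite block_diag_mx_unit unitmx1 hU.
pose B : 'M_(1 + n.+1) :=
  block_mx (ulsubmx D') (a *: 'e_0) (h *m dlsubmx D') H.
have kDB : k *m D' = B *m k.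
  rewrite -[D']submxK !mulmx_block !mul1mx !mul0mx !mulmx1 !mulmx0 !addr0 !add0r.
  by rewrite hEH -scalemxAl -rowE h0 -Ea.
exists (k *m g), B; split.
- by rewrite unitmx_mul kU gU.
- rewrite row_mul -g0 [RHS]rowE; congr (_ *m _).
  have -> : 0 = lshift n.+1 (0 : 'I_1) :> 'I_(1 + n.+1) by apply: val_inj.
  apply/rowP=> j; rewrite [LHS]mxE [RHS]mxE eqxx /=.
  case: (split_ordP j) => j' ->.
    by rewrite [LHS](block_mxEul _ _ _ _ 0 j') [j']ord1 mxE !eqxx.
  by rewrite [LHS](block_mxEur _ _ _ _ 0 j') mxE -val_eqE.
- move=> i j; case: (@split_ordP 1 n.+1 i) => i' ->;
    case: (@split_ordP 1 n.+1 j) => j' -> /=.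
  + by rewrite [j']ord1.
  + rewrite [B _ _](block_mxEur _ _ _ _ i' j') !mxE [i']ord1 /=.
    by case: j' => [[|j'] ?] //= _; rewrite mulr0.
  + by rewrite [j']ord1.
  + by rewrite [B _ _](block_mxEdr _ _ _ _ i' j') !add1n ltnS; apply: hH.
- have gD : D' *m (g : 'M_(1 + n.+1)) = g *m D := mulmxKV gU _.
  by rewrite -[LHS]mulmxA -gD; rewrite [LHS]mulmxA kDB -[LHS]mulmxA.
Qed.

(** If all unit vectors e_i and all sums e_0 + e_i are eigenvectors, the first
    family makes A diagonal and the second makes its diagonal entries equal. *)
Lemma non_eigenvector (K : fieldType) (n : nat) (A : 'M[K]_n) :
  ~~ is_scalar_mx A -> exists w : 'rV_n, ~~ (w *m A <= w)%MS.
Proof.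
case: n A => [|n] A nA.
  by case/negP: nA; rewrite [A]flatmx0 mx0_is_scalar.
pose e (i : 'I_n.+1) : 'rV[K]_n.+1 := 'e_i.
pose f (i : 'I_n.+1) : 'rV[K]_n.+1 := 'e_0 + 'e_i.
have [/existsP[i eiA]|/existsPn eigA] :=
  boolP [exists i, ~~ (e i *m A <= e i)%MS].
  by exists (e i).
have [/existsP[i eiA]|/existsPn eig0A] :=
  boolP [exists i, ~~ (f i *m A <= f i)%MS].
  by exists (f i).
have diagA i j : i != j -> A i j = 0.
  move=> ij; have /negPn/sub_rVP[a] := eigA i.
  rewrite /e -rowE => /rowP/(_ j).
  by rewrite !mxE eq_sym (negPf ij) andbF mulr0.
case/negP: nA; apply/is_scalar_mxP; exists (A 0 0).
apply/matrixP=> i j; rewrite mxE.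
have [<-|ij] := eqVneq i j; last by rewrite (diagA _ _ ij).
rewrite mulrb; have [->//|i0] := eqVneq i 0.
have /negPn/sub_rVP[a] := eig0A i.
rewrite /f mulmxDl -!rowE => /rowP Ea.
have := Ea i; have := Ea 0; rewrite !mxE !eqxx (negPf i0) eq_sym (negPf i0) /=.
rewrite (diagA i 0) // (diagA 0 i) 1?eq_sym //.
by rewrite !addr0 !add0r !mulr1 => -> ->.
Qed.

(** Conjugation by g = 1 + x E_(1, 0) adds x times row 0 to row 1 and subtracts
    x times column 1 from column 0. On a Hessenberg matrix this creates no entry
    above the first superdiagonal, and among the odd-indexed diagonal entries it
    changes only the one of index 1, by x B_(0, 1). *)
Lemma hessenberg_shear (K : fieldType) (n : nat) (B : 'M[K]_n.+2)
    (i1 : 'I_n.+2) :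
  i1 = 1%N :> nat -> hessenberg B -> B 0 i1 != 0 ->
  exists g B' : 'M[K]_n.+2,
    [/\ g \in unitmx, hessenberg B', g *m B = B' *m g
      & \sum_(i < n.+2 | odd i) B' i i = 0].
Proof.
move=> Ei1 hB b01; pose E : 'M[K]_n.+2 := delta_mx i1 0.
have i10 : i1 != 0 by apply: contra_eq_neq Ei1 => ->.
have EE : E *m E = 0 by rewrite mul_delta_mx_0 // eq_sym.
pose x := - (\sum_(i < n.+2 | odd i) B i i) / B 0 i1.
pose g := 1%:M + x *: E; pose g' := 1%:M - x *: E.
have g'g : g' *m g = 1%:M.
  rewrite mulmxDr mulmx1 mulmxDl mul1mx mulNmx -scalemxAl -scalemxAr EE.
  by rewrite !scaler0 oppr0 addr0 subrK.
have [_ gU] := mulmx1_unit g'g.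
have entryB' i j : (g *m B *m g') i j = B i j + x * (B 0 j *+ (i == i1))
    - x * ((B i i1 + x * (B 0 i1 *+ (i == i1))) *+ (j == 0)).
  have mulE (M : 'M_n.+2) k l : (M *m E) k l = M k i1 *+ (l == 0).
    rewrite mxE (bigD1 i1) //= big1 ?addr0 => [|m mi].
      by rewrite mxE eqxx /= mulr_natr.
    by rewrite mxE (negPf mi) mulr0.
  have Emul (M : 'M_n.+2) k l : (E *m M) k l = M 0 l *+ (k == i1).
    rewrite mxE (bigD1 0) //= big1 ?addr0 => [|m mi].
      by rewrite mxE eqxx andbT mulr_natl.
    by rewrite mxE (negPf mi) andbF mul0r.
  have gE k l : (g *m B) k l = B k l + x * (B 0 l *+ (k == i1)).
    by rewrite mulmxDl mul1mx -scalemxAl 2!mxE Emul.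
  rewrite mulmxDr mulmx1 mulmxN -scalemxAr [LHS]mxE gE.
  by rewrite [X in _ + X]mxE [X in _ - X]mxE mulE gE.
exists g, (g *m B *m g'); split=> //.
- move=> i j ij; have j2 : (1 < j)%N by apply: leq_ltn_trans ij.
  rewrite entryB' hB // add0r.
  have -> : (j == 0) = false by apply: contraTF j2 => /eqP->.
  rewrite mulr0 subr0; have [Ei|_] := eqVneq i i1; last by rewrite mulr0.
  by rewrite hB ?mulr0 //; move: ij; rewrite Ei Ei1; apply: ltnW.
- by rewrite -[RHS]mulmxA g'g mulmx1.
rewrite (eq_bigr (fun i => B i i + x * (B 0 i *+ (i == i1)))); last first.
  move=> i oi; rewrite entryB'.
  have -> : (i == 0) = false by apply: contraTF oi => /eqP->.
  by rewrite mulr0 subr0.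
rewrite big_split -mulr_sumr /= [X in _ + _ * X](bigD1 i1) ?Ei1 //=.
rewrite [X in _ + _ * (_ + X)]big1.
  by rewrite addr0 eqxx mulr1n divfK // subrr.
by move=> i /andP[_ /negPf->].
Qed.

(** The entry B_(0, 1) of the Hessenberg form is nonzero because otherwise w, the
    first basis vector, would be an eigenvector. *)
Lemma hessenberg_balanced (K : fieldType) (n : nat) (A : 'M[K]_n) :
  ~~ is_scalar_mx A ->
  exists g B : 'M[K]_n, [/\ g \in unitmx, hessenberg B, g *m A = B *m g &
    \sum_(i < n | odd i) B i i = 0].
Proof.
move=> nA; have [w wA] := non_eigenvector nA.
case: n A nA w wA => [|[|n]] A nA w wA.
- by case/negP: nA; rewrite [A]flatmx0 mx0_is_scalar.
- by case/negP: nA; rewrite [A]mx11_scalar scalar_mx_is_scalar.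
have w0 : w != 0 by apply: contraNneq wA => ->; rewrite mul0mx sub0mx.
have [g [B [gU g0 hB gA]]] := hessenberg_form A w0.
pose i1 : 'I_n.+2 := inord 1.
have Ei1 : i1 = 1%N :> nat by rewrite inordK.
have b01 : B 0 i1 != 0.
  apply: contra wA => /eqP b01; apply/sub_rVP; exists (B 0 0).
  have rB : row 0 B = B 0 0 *: 'e_0.
    apply/rowP=> j; rewrite !mxE eqxx /=; have [->|j0] := eqVneq j 0.
      by rewrite mulr1.
    rewrite mulr0; have [->//|j1] := eqVneq j i1.
    apply: hB; rewrite ltn_neqAle lt0n j0 andbT.
    by apply: contra j1 => /eqP Ej; apply/eqP/val_inj; rewrite /= Ei1.
  by rewrite -g0 -row_mul gA row_mul rB -scalemxAl -rowE.
have [h [B' [hU hB' hB'B sB']]] := hessenberg_shear Ei1 hB b01.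
exists (h *m g), B'; split=> //; first by rewrite unitmx_mul hU.
by rewrite -mulmxA gA !mulmxA hB'B.
Qed.

(** * The centralizer of the matrix P *)

Lemma mulP_mxE (K : fieldType) (n : nat) (p : nat) (Z : 'M[K]_(n, p)) i j :
  (P_mx K n *m Z) i j =
  (odd i)%:R * Z i j + \sum_(k < n | i == k.+2 :> nat) Z k j.
Proof.
rewrite mxE [X in _ + X]big_mkcond.
rewrite (eq_bigr (fun k : 'I_n => ((i == k) && odd i)%:R * Z k j +
  (if i == k.+2 :> nat then Z k j else 0))) => [|k _].
  rewrite big_split /=; congr (_ + _); rewrite (bigD1 i) //= eqxx /= big1.
    by rewrite addr0.
  by move=> k ki; rewrite eq_sym (negPf ki) mul0r.
rewrite mxE -(inj_eq val_inj) /=; case: (i == k.+2 :> nat) / eqP => [->|_].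
  by rewrite gtn_eqF //= mul0r mul1r add0r.
by rewrite orbF addr0.
Qed.

Lemma mul_P_mxE (K : fieldType) (n : nat) (p : nat) (Z : 'M[K]_(p, n)) i j :
  (Z *m P_mx K n) i j =
  (odd j)%:R * Z i j + \sum_(k < n | k == j.+2 :> nat) Z i k.
Proof.
rewrite mxE [X in _ + X]big_mkcond.
rewrite (eq_bigr (fun k : 'I_n => ((k == j) && odd j)%:R * Z i k +
  (if k == j.+2 :> nat then Z i k else 0))) => [|k _].
  rewrite big_split /=; congr (_ + _); rewrite (bigD1 j) //= eqxx /= big1.
    by rewrite addr0.
  by move=> k kj; rewrite (negPf kj) mul0r.
rewrite mxE -(inj_eq val_inj) /= mulrC; case: (k == j.+2 :> nat) / eqP => [->|_].
  by rewrite gtn_eqF //= mul0r mul1r add0r.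
rewrite orbF addr0; case: eqP => [->//|_]; by rewrite mul0r.
Qed.

Lemma ord_pred2 (n : nat) (j : 'I_n) :
  (1 < j)%N -> exists l : 'I_n, j = l.+2 :> nat.
Proof.
move=> j1; have jn : (j.-2 < n)%N.
  by apply: leq_ltn_trans (ltn_ord j); rewrite -subn2 leq_subr.
by exists (Ordinal jn) => /=; case: (nat_of_ord j) j1 => [|[]].
Qed.

Lemma centralizer_P_entry (K : fieldType) (n : nat) (Z : 'M[K]_n) (i j : 'I_n) :
  P_mx K n *m Z = Z *m P_mx K n ->
  (odd i)%:R * Z i j + \sum_(k < n | i == k.+2 :> nat) Z k j =
  (odd j)%:R * Z i j + \sum_(k < n | k == j.+2 :> nat) Z i k.
Proof. by move=> PZ; rewrite -mulP_mxE PZ mul_P_mxE. Qed.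

(** Comparing the (i, j) entries of P Z and Z P expresses Z_(i, j), up to sign,
    through Z_(i-2, j) and Z_(i, j+2), where out-of-range entries are 0; both
    have parities that differ again, and i - j has become smaller. *)
Lemma centralizer_P_parity (K : fieldType) (n : nat) (Z : 'M[K]_n) (i j : 'I_n) :
  P_mx K n *m Z = Z *m P_mx K n -> odd i != odd j -> Z i j = 0.
Proof.
move=> PZ; have [m] := ubnP (i + (n - j)).
elim: m i j => // m IH i j ijm odd_ij.
have := centralizer_P_entry i j PZ; rewrite !big1 => [|k /eqP Ek|k /eqP Ek].
- by case: (odd i) (odd j) odd_ij => -[] //= _; rewrite !mul0r !mul1r !addr0.
- apply: IH; last by rewrite Ek /= negbK.
  rewrite -ltnS; apply: leq_trans ijm.
  by rewrite ltnS ltn_add2l ltn_sub2l ?Ek.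
- apply: IH; last by move: odd_ij; rewrite Ek /= negbK.
  by rewrite -ltnS; apply: leq_trans ijm; rewrite ltnS ltn_add2r Ek leqW.
Qed.

(** On indices of equal parity the eigenvalues cancel, so Z is constant along the
    steps (2, 2); above the diagonal such a chain leaves the matrix through its
    top rows, where it meets the value 0. *)
Lemma centralizer_P_lower (K : fieldType) (n : nat) (Z : 'M[K]_n) (i j : 'I_n) :
  P_mx K n *m Z = Z *m P_mx K n -> (i < j)%N -> Z i j = 0.
Proof.
move=> PZ; have [m] := ubnP i; elim: m i j => // m IH i j im ij.
have [odd_ij|] := eqVneq (odd i) (odd j); last exact: centralizer_P_parity.
have /ord_pred2[l El] : (1 < j)%N.
  by case: (j : nat) ij odd_ij => [|[|//]] //; case: (i : nat).
have := centralizer_P_entry i l PZ; rewrite odd_ij El /= negbK => /addrI.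
rewrite [RHS](bigD1 j) ?El //= [X in _ = _ + X]big1 ?addr0; last first.
  by move=> k /andP[/eqP Ek]; rewrite -val_eqE /= Ek El eqxx.
move=> <-; apply: big1 => k /eqP Ek; apply: IH.
  by rewrite -ltnS; apply: leq_trans im; rewrite Ek leqW.
by rewrite -2!ltnS -El -Ek.
Qed.

Lemma centralizer_P_diag (K : fieldType) (n : nat) (Z : 'M[K]_n) (i j : 'I_n) :
  P_mx K n *m Z = Z *m P_mx K n -> odd i = odd j -> Z i i = Z j j.
Proof.
move=> PZ; have step (k l : 'I_n) : l = k.+2 :> nat -> Z k k = Z l l.
  move=> El; have := centralizer_P_entry l k PZ; rewrite El /= negbK => /addrI.
  rewrite (bigD1 k) //= [X in _ + X]big1 ?addr0; last first.
    by move=> p /andP[/eqP[Ep]]; rewrite -val_eqE /= Ep eqxx.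
  rewrite (bigD1 l) ?El //= [X in _ = _ + X]big1 ?addr0 //.
  by move=> p /andP[/eqP Ep]; rewrite -val_eqE /= Ep El eqxx.
wlog: i j / (i <= j)%N => [hw|ij odd_ij].
  have [/hw//|/ltnW/hw h] := leqP i j; by move/esym/h.
have [m] := ubnP j; elim: m j ij odd_ij => // m IH j ij odd_ij jm.
have [Eij|Nij] := eqVneq i j; first by rewrite Eij.
have ij2 : (i.+1 < j)%N.
  rewrite ltn_neqAle; apply/andP; split; last by rewrite ltn_neqAle Nij.
  by apply: contra_eq_neq odd_ij => <- /=; case: odd.
have [l El] := ord_pred2 (leq_ltn_trans (ltn0Sn i) ij2).
rewrite -(step _ _ El); apply: IH.
- by rewrite -2!ltnS -El.
- by rewrite odd_ij El /= negbK.
- by rewrite -ltnS; apply: leq_trans jm; rewrite El leqW.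
Qed.

(** In tr (B Z) the entry Z_(j, i) pairs with B_(i, j). It vanishes for j < i by
    triangularity and for j = i + 1 by parity, while B_(i, j) vanishes beyond
    that. What remains is a sum over the diagonal, in which Z contributes one
    constant for each parity. *)
Lemma hessenberg_bracket_P (K : fieldType) (n : nat) (B : 'M[K]_n) :
  hessenberg B -> \tr B = 0 -> \sum_(i < n | odd i) B i i = 0 ->
  exists Y, B = mxbracket (P_mx K n) Y.
Proof.
move=> hB trB oddB; apply: mxbracket_range => Z PZ.
have diag i : (B *m Z) i i = B i i * Z i i.
  rewrite mxE (bigD1 i) //= big1 ?addr0 // => j ji.
  have [jlt|ilt|/val_inj Eij] := ltngtP j i; last by rewrite Eij eqxx in ji.
    by rewrite (centralizer_P_lower PZ) ?mulr0.
  have [Ej|Nj] := eqVneq (j : nat) i.+1.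
    by rewrite (centralizer_P_parity PZ) ?mulr0 // Ej /=; case: odd.
  by rewrite hB ?mul0r // ltn_neqAle eq_sym Nj.
have evenB : \sum_(i < n | ~~ odd i) B i i = 0.
  by move: trB; rewrite /mxtrace (bigID (fun i : 'I_n => odd i)) /= oddB add0r.
have part (p : pred 'I_n) : (forall i j, p i -> p j -> odd i = odd j) ->
    \sum_(i | p i) B i i = 0 -> \sum_(i | p i) B i i * Z i i = 0.
  move=> odd_p sB; case: (pickP p) => [j pj|none]; last by rewrite big_pred0.
  rewrite (eq_bigr (fun i => B i i * Z j j)) => [|i pi].
    by rewrite -mulr_suml sB mul0r.
  by rewrite (centralizer_P_diag PZ (odd_p i j pi pj)).
rewrite /mxtrace (eq_bigr _ (fun i _ => diag i)).
rewrite (bigID (fun i : 'I_n => odd i)) /= !part ?addr0 // => i j.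
  by move=> /negPf-> /negPf->.
by move=> -> ->.
Qed.

(** * The centralizer of the Jordan block *)

Lemma mulJ0_mxE (K : fieldType) (n p : nat) (Z : 'M[K]_(n, p)) i j :
  (J0_mx K n *m Z) i j = \sum_(k < n | i == k.+1 :> nat) Z k j.
Proof.
rewrite mxE [RHS]big_mkcond; apply: eq_bigr => k _; rewrite mxE.
by case: eqP; rewrite (mul1r, mul0r).
Qed.

Lemma mul_J0_mxE (K : fieldType) (n p : nat) (Z : 'M[K]_(p, n)) i j :
  (Z *m J0_mx K n) i j = \sum_(k < n | k == j.+1 :> nat) Z i k.
Proof.
rewrite mxE [RHS]big_mkcond; apply: eq_bigr => k _; rewrite mxE.
by case: eqP; rewrite (mulr1, mulr0).
Qed.

Lemma centralizer_J0_diag (K : fieldType) (n : nat) (Z : 'M[K]_n.+1) i :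
  J0_mx K n.+1 *m Z = Z *m J0_mx K n.+1 -> Z i i = Z 0 0.
Proof.
move=> JZ; case: i => i; elim: i => [|i IH] lti.
  by congr (Z _ _); apply: val_inj.
rewrite -(IH (ltnW lti)); set k := Ordinal (ltnW lti); set l := Ordinal lti.
have := congr1 (fun M : 'M_n.+1 => M l k) JZ; rewrite mulJ0_mxE mul_J0_mxE.
rewrite (bigD1 k) //= [X in _ + X]big1 ?addr0; last first.
  by move=> p /andP[/eqP[Ep]]; rewrite -val_eqE /= Ep eqxx.
rewrite (bigD1 l) //= [X in _ = _ + X]big1 ?addr0 //.
by move=> p /andP[/eqP Ep]; rewrite -val_eqE /= Ep eqxx.
Qed.

(** The trace n a of A vanishes although a itself need not, the characteristic
    being arbitrary; so the diagonal of Z has to be constant. *)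
Lemma scalar_bracket_J0 (K : fieldType) (n : nat) (A : 'M[K]_n.+1) :
  is_scalar_mx A -> \tr A = 0 -> exists Y, A = mxbracket (J0_mx K n.+1) Y.
Proof.
case/is_scalar_mxP=> a -> tra; apply: mxbracket_range => Z JZ.
rewrite mul_scalar_mx mxtraceZ /mxtrace.
rewrite (eq_bigr (fun=> Z 0 0)) => [|i _]; last exact: centralizer_J0_diag.
rewrite sumr_const card_ord -mulr_natl mulrA mulr_natr.
by move: tra; rewrite mxtrace_scalar => ->; rewrite mul0r.
Qed.

(** * Regularity of the two models *)

Lemma cyclic_J0 (K : fieldType) (n : nat) :
  cyclic_vector (J0_mx K n) (\col_(i < n) (i == 0 :> nat)%:R).
Proof.
set v := \col__ _.
have newtonE k i : newton (J0_mx K n) (fun=> 0) v k i 0 = (i == k :> nat)%:R.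
  elim: k i => [|k IH] i /=; first by rewrite mxE.
  rewrite scale0r subr0 mulJ0_mxE.
  have [Ei|Ni] := eqVneq (i : nat) k.+1.
    have kn : (k < n)%N by rewrite ltnW // -Ei.
    rewrite (bigD1 (Ordinal kn)) ?Ei //= IH eqxx big1 ?addr0 // => p.
    by case/andP=> /eqP[Ep]; rewrite -val_eqE /= Ep eqxx.
  rewrite big1 // => p /eqP Ep; rewrite IH; case: eqP => // Epk.
  by rewrite Ep Epk eqxx in Ni.
apply: (@cyclic_newton _ _ _ (fun=> 0)) => [i j ij|i]; rewrite newtonE.
  by rewrite ltn_eqF.
by rewrite eqxx oner_neq0.
Qed.

(** The start vector e_0 + e_1 generates both Jordan blocks, and alternating the
    factors X and X - 1 advances the two of them in turn. The factor applied at
    step k has the eigenvalue of the block containing index k: it kills the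
    leading entry k, multiplies entry k + 1 by 1 or -1, and moves the old leading
    entry to k + 2. This is why two consecutive leading entries have to be tracked
    as nonzero. *)
Lemma cyclic_P (K : fieldType) (n : nat) :
  cyclic_vector (P_mx K n) (\col_(i < n) (i < 2)%:R).
Proof.
set v := \col__ _; pose c k : K := (odd k)%:R; pose u := newton (P_mx K n) c v.
have uS k i : u k.+1 i 0 = ((odd i)%:R - (odd k)%:R) * u k i 0
    + \sum_(p < n | i == p.+2 :> nat) u k p 0.
  by rewrite /u /= mxE mulP_mxE -/u [X in _ + X]mxE mxE addrAC -mulrBl.
have inv k : (forall i : 'I_n, (i < k)%N -> u k i 0 = 0) /\
    (forall i : 'I_n, (k <= i <= k.+1)%N -> u k i 0 != 0).
  elim: k => [|k [IH0 IH1]].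
    by split=> // i /=; rewrite mxE ltnS => ->; rewrite oner_neq0.
  split=> i; rewrite uS.
    rewrite ltnS => ik; rewrite big1 => [|p /eqP Ep]; last first.
      by rewrite IH0 //; apply: ltnW; rewrite -Ep.
    move: ik; rewrite leq_eqVlt => /orP[/eqP->|ik].
      by rewrite subrr mul0r addr0.
    by rewrite IH0 // mulr0 addr0.
  case/andP; rewrite leq_eqVlt => /orP[/eqP Ei _|ki ik].
    rewrite big1 => [|p /eqP Ep].
      rewrite addr0 mulf_neq0 ?IH1 -?Ei ?leqnSn ?leqnn //=.
      by case: odd; rewrite ?subr0 ?sub0r ?oppr_eq0 oner_neq0.
    by rewrite IH0 // -ltnS -[p.+1]/(p.+2.-1) -Ep -Ei.
  have Ei : i = k.+2 :> nat by apply/eqP; rewrite eqn_leq ik.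
  have kn : (k < n)%N by apply/ltnW/ltnW; rewrite -Ei.
  rewrite Ei /= negbK subrr mul0r add0r (bigD1 (Ordinal kn)) //=.
  rewrite big1 ?addr0 => [|p]; first by rewrite IH1 //= leqnn leqnSn.
  by case/andP=> /eqP[Ep]; rewrite -val_eqE /= Ep eqxx.
apply: (@cyclic_newton _ _ _ c) => [i j ij|i].
  by case: (inv j) => ->.
by case: (inv i) => _ -> //; rewrite leqnn leqnSn.
Qed.

Theorem proposition4p1 (K : fieldType) (n : nat) (hn : (0 < n)%N)
    (A : 'M[K]_n) (trA : \tr A = 0) :
  (exists X Y : 'M[K]_n, regular_mx X /\ A = mxbracket X Y) /\
  (~~ is_scalar_mx A ->
     exists X Y : 'M[K]_n,
       [/\ regular_mx X, conjugate_mx X (P_mx K n) & A = mxbracket X Y]) /\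
  (is_scalar_mx A ->
     regular_mx (J0_mx K n) /\
     exists Y : 'M[K]_n, A = mxbracket (J0_mx K n) Y).
Proof.
have nonscalar : ~~ is_scalar_mx A -> exists X Y : 'M[K]_n,
    [/\ regular_mx X, conjugate_mx X (P_mx K n) & A = mxbracket X Y].
  move=> /hessenberg_balanced[g [B [gU hB gA oddB]]].
  have trB : \tr B = 0.
    by rewrite -[B](mulmxK gU) -gA mxtrace_mulC mulKmx.
  have [Y EB] := hessenberg_bracket_P hB trB oddB.
  exists (invmx g *m P_mx K n *m g), (invmx g *m Y *m g).
  have conjP : conjugate_mx (invmx g *m P_mx K n *m g) (P_mx K n).
    by exists (invmx g); rewrite ?unitmx_inv ?invmxK.
  split=> //; last exact: conj_bracket gA EB.
  have [h hU ->] := conjP.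
  exact: regular_cyclic (cyclic_vector_conj hU (@cyclic_P K n)).
have scalar : is_scalar_mx A -> regular_mx (J0_mx K n) /\
    exists Y : 'M[K]_n, A = mxbracket (J0_mx K n) Y.
  move=> sA; split; first exact: regular_cyclic (@cyclic_J0 K n).
  by case: n hn A trA sA {nonscalar} => // n _ A trA sA; apply: scalar_bracket_J0.
split; last by [].
have [/scalar[regJ [Y EA]]|/nonscalar[X [Y [regX _ EA]]]] :=
  boolP (is_scalar_mx A).
  by exists (J0_mx K n), Y.
by exists X, Y.
Qed.
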